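(* Let $\mathbb{F}$ be a finite field of constant characteristic $q$. Let $f,g\in\mathbb{F}[x_1,\dots,x_n]$ be $f=\prod_{i<j}(x_i+x_j+1)$ and $g=\prod_{i=1}^n(1-x_i)-1$. Then the system of equations $f=0$, $g=0$, $x_i^2-x_i=0$ ($i\in[n]$) is unsatisfiable, and every roABP-$\mathrm{IPS}_{\mathrm{LIN}'}$ refutation of it (in any order of the variables) has size $\exp(\Omega(n))$.
   Context: A read-once oblivious algebraic branching program (roABP) in variable order $v_{\pi(1)}<\dots<v_{\pi(N)}$ is a layered DAG with layers $V_0,\dots,V_N$, unique source in $V_0$, unique sink in $V_N$, edges only from $V_{\ell-1}$ to $V_\ell$ each labelled by a univariate polynomial in $v_{\pi(\ell)}$; it computes the sum over source–sink paths of the products of labels. Width $r=\max_\ell|V_\ell|$; size $N\cdot r\cdot D\cdot N$ with $D$ the maximal individual degree of labels. A roABP-$\mathrm{IPS}_{\mathrm{LIN}'}$ refutation of $\{f=0,g=0\}$ with Boolean axioms is a polynomial $C(\bar x,t_1,t_2,s_1,\dots,s_n)$ computed by an roABP (in some order of all its variables) with $C(\bar x,0,0,\bar0)=0$, $C(\bar x,f,g,x_1^2-x_1,\dots,x_n^2-x_n)=1$, and $C$ of degree $\le1$ in $t_1$ and in $t_2$; its size is the roABP's size. *)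

(* Defs.v *)
From mathcomp Require Import all_boot all_order all_fingroup all_algebra.
From mathcomp Require Import mpoly.

Set Implicit Arguments.
Unset Strict Implicit.
Unset Printing Implicit Defensive.

Import GRing.Theory.
Local Open Scope ring_scope.

(* [ro_order l] is the variable read between layers l and l+1, so the order
   v_{pi(1)} < ... < v_{pi(N)} is 'X_(ro_order 0), ..., 'X_(ro_order (N-1)).
   Values of [ro_label] on pairs that are not edges are never used. *)
Record roABP (F : fieldType) (N : nat) := RoABP {
  ro_vertex : finType;
  ro_layer : ro_vertex -> 'I_N.+1;
  ro_source : ro_vertex;
  ro_sink : ro_vertex;
  ro_sourceP : forall v, (ro_layer v == ord0) = (v == ro_source);
  ro_sinkP : forall v, (ro_layer v == ord_max) = (v == ro_sink);
  ro_edge : rel ro_vertex;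
  ro_edgeP : forall u v, ro_edge u v -> ro_layer v = (ro_layer u).+1 :> nat;
  ro_label : ro_vertex -> ro_vertex -> {poly F};
  ro_order : 'S_N
}.

Section RoABP.
Variables (F : fieldType) (N : nat) (A : roABP F N).

(* The l-th edge of a path p goes from p l to p (l+1). *)
Definition ro_path (p : {ffun 'I_N.+1 -> ro_vertex A}) : bool :=
  [&& p ord0 == ro_source A, p ord_max == ro_sink A &
      [forall l : 'I_N, ro_edge (p (widen_ord (leqnSn N) l)) (p (lift ord0 l))]].

Definition ro_poly : {mpoly F[N]} :=
  \sum_(p | ro_path p) \prod_(l < N)
    horner_alg ('X_(ro_order A l) : {mpoly F[N]})
      (ro_label (p (widen_ord (leqnSn N) l)) (p (lift ord0 l))).

Definition ro_width : nat :=
  (\max_(l < N.+1) #|[set v : ro_vertex A | ro_layer v == l]|)%N.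

Definition ro_degree : nat :=
  (\max_(e : ro_vertex A * ro_vertex A | ro_edge e.1 e.2)
     (size (ro_label e.1 e.2)).-1)%N.

Definition ro_size : nat := (N * ro_width * ro_degree * N)%N.

End RoABP.

(* The variables x_1..x_n, t_1, t_2, s_1..s_n of C, in this order, are those
   of {mpoly F[n + (2 + n)]}; [ips_subst] is C(x, a, b, h_1, ..., h_n). *)
Section IPS.
Variables (F : fieldType) (n : nat).
Implicit Types (C : {mpoly F[n + (2 + n)]}) (f g a b : {mpoly F[n]}).

Definition ips_subst C a b (h : 'I_n -> {mpoly F[n]}) : {mpoly F[n]} :=
  C \mPo [tuple of [tuple 'X_i | i < n] ++
           ([tuple of [tuple a; b] ++ [tuple h i | i < n]])].

Definition t_var (k : 'I_2) : 'I_(n + (2 + n)) := rshift n (lshift n k).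

Definition bool_axiom (i : 'I_n) : {mpoly F[n]} := 'X_i ^+ 2 - 'X_i.

Definition ips_lin'_refutation f g C : Prop :=
  [/\ ips_subst C 0 0 (fun=> 0) = 0,
      ips_subst C f g bool_axiom = 1
    & forall (k : 'I_2) (m : 'X_{1.. n + (2 + n)}),
        m \in msupp C -> (m (t_var k) <= 1)%N].

Definition roABP_ips_lin'_refutation f g (A : roABP F (n + (2 + n))) : Prop :=
  ips_lin'_refutation f g (ro_poly A).

Definition satisfiable f g : Prop :=
  exists a : 'I_n -> F,
    [/\ f.@[a] = 0, g.@[a] = 0 & forall i, (bool_axiom i).@[a] = 0].

End IPS.

Definition f_poly (F : fieldType) (n : nat) : {mpoly F[n]} :=
  \prod_(i < n) \prod_(j < n | (i < j)%N) ('X_i + 'X_j + 1).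

Definition g_poly (F : fieldType) (n : nat) : {mpoly F[n]} :=
  \prod_(i < n) (1 - 'X_i) - 1.

(* Main.v *)
(* The refutation satisfies C(x, f, g, x^2 - x) = 1, so D := 1 - C(x, 0, g, x^2 - x)
   vanishes wherever f does, while D(0) = 1 because C(x, 0, 0, 0) = 0.  An roABP
   reads each index i twice, through x_i and through s_i.  Cut its reading order
   into four blocks of almost equal size: for some pairing of the blocks, linearly
   many indices have both reads in the first pair of blocks, and linearly many have
   both in the second.  This gives disjoint index sets Y and Z of size m = Omega(n),
   matched by some y -> z.

   Keep all other variables generic.  Since C has degree at most 1 in t_2 and
   g + 1 is a product of univariate factors, D has rank O(r^4) as a matrix
   indexed by assignments to Y and to Z, where r is the width.  Let each x_y range
   over {X_y, -1 - X_z} and its partner x_z over {X_z, -1 - X_y}.  If the two choices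
   of a matched pair differ, then x_y + x_z + 1 = 0, so f and hence D vanish; if all
   choices agree, the point is the image of the generic point under an involution,
   and D is nonzero there.  So D contains a nonsingular diagonal matrix of size
   2^m, and r is exponential in n. *)
Require Import Defs.
From mathcomp Require Import all_boot all_order all_fingroup all_algebra.
From mathcomp Require Import reals sequences exp.
From mathcomp Require Import mpoly.
From mathcomp Require Import zify ring.

Set Implicit Arguments.
Unset Strict Implicit.
Unset Printing Implicit Defensive.

Import GRing.Theory Num.Theory.
Local Open Scope ring_scope.

(** * Rank of two-argument functions with values in a commutative ring *)

Section RankAtMost.
Variables (R : comNzRingType) (S T : Type).
Implicit Types (M : S -> T -> R) (k : nat).

(** Encoded as a factorisation, so that it makes sense over any commutative ring and for arbitrary
    index types. *)
Definition rank_at_most k M : Prop :=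
  exists (A : 'I_k -> S -> R) (B : 'I_k -> T -> R),
    forall s t, M s t = \sum_i A i s * B i t.

Lemma eq_rank_at_most k M M' :
  M =2 M' -> rank_at_most k M -> rank_at_most k M'.
Proof. by move=> eqM [A [B MAB]]; exists A, B => s t; rewrite -eqM. Qed.

Lemma rank_at_most0 : rank_at_most 0 (fun _ _ => 0).
Proof. by exists (fun _ _ => 0), (fun _ _ => 0) => s t; rewrite big_ord0. Qed.

Lemma rank_at_most1 (a : S -> R) (b : T -> R) :
  rank_at_most 1 (fun s t => a s * b t).
Proof. by exists (fun=> a), (fun=> b) => s t; rewrite big_ord1. Qed.

Lemma rank_at_mostD k k' M M' :
  rank_at_most k M -> rank_at_most k' M' ->
  rank_at_most (k + k') (fun s t => M s t + M' s t).
Proof.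
move=> [A [B MAB]] [A' [B' MAB']].
exists (fun i => match split i with inl j => A j | inr j => A' j end).
exists (fun i => match split i with inl j => B j | inr j => B' j end).
move=> s t; rewrite big_split_ord /= MAB MAB'.
by congr (_ + _); apply: eq_bigr => i _;
  rewrite ?(unsplitK (inl i)) ?(unsplitK (inr i)).
Qed.

Lemma rank_at_mostM k (a : S -> R) (b : T -> R) M :
  rank_at_most k M -> rank_at_most k (fun s t => a s * b t * M s t).
Proof.
move=> [A [B MAB]]; exists (fun i s => a s * A i s), (fun i t => b t * B i t).
by move=> s t; rewrite MAB mulr_sumr; apply: eq_bigr => i _; ring.
Qed.

Lemma rank_at_most_const (c : R) : rank_at_most 1 (fun _ _ => c).
Proof.
by apply: eq_rank_at_most (rank_at_most1 (fun=> c) (fun=> 1)) => s t /=; ring.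
Qed.

Lemma rank_at_mostZ k (c : R) M :
  rank_at_most k M -> rank_at_most k (fun s t => c * M s t).
Proof.
move=> /(rank_at_mostM (fun=> c) (fun=> 1)).
by apply: eq_rank_at_most => s t /=; ring.
Qed.

Lemma rank_at_most_leq k k' M :
  (k <= k')%N -> rank_at_most k M -> rank_at_most k' M.
Proof.
move=> /subnK <-; elim: (k' - k)%N => // d IH rkM.
apply: eq_rank_at_most (rank_at_mostD (rank_at_most_const 0) (IH rkM)) => s t.
exact: add0r.
Qed.

Lemma rank_at_most_sum (J : Type) (r : seq J) k (M : J -> S -> T -> R) :
  (forall j, rank_at_most k (M j)) ->
  rank_at_most (size r * k) (fun s t => \sum_(j <- r) M j s t).
Proof.
move=> rkM; elim: r => [|j r IH].
  by apply: eq_rank_at_most rank_at_most0 => s t; rewrite big_nil.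
rewrite /= mulSn; apply: eq_rank_at_most (rank_at_mostD (rkM j) IH) => s t.
by rewrite big_cons.
Qed.

End RankAtMost.

(** Over the fraction field the diagonal matrix is invertible, hence of rank [#|S|], while it
    factors through dimension [k]. *)
Lemma rank_at_most_diag (R : idomainType) (S : finType) (k : nat)
    (M : S -> S -> R) :
  (forall s t, s != t -> M s t = 0) -> (forall s, M s s != 0) ->
  rank_at_most k M -> (#|S| <= k)%N.
Proof.
move=> M0 Mn0 [A [B MAB]].
pose K := {fraction R}.
pose MA : 'M[K]_(#|S|, k) := \matrix_(i, j) tofrac (A j (enum_val i)).
pose MB : 'M[K]_(k, #|S|) := \matrix_(i, j) tofrac (B i (enum_val j)).
pose d : 'rV[K]_#|S| := \row_i tofrac (M (enum_val i) (enum_val i)).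
have dE : diag_mx d = MA *m MB.
  apply/matrixP => i j; rewrite !mxE.
  have -> : \sum_l MA i l * MB l j = tofrac (M (enum_val i) (enum_val j)).
    rewrite MAB rmorph_sum; apply: eq_bigr => l _.
    by rewrite !mxE rmorphM.
  case: eqVneq => [->|neq_ij]; rewrite ?mulr1n // mulr0n M0 ?rmorph0 //.
  by rewrite (inj_eq enum_val_inj).
have : \rank (diag_mx d) = #|S|.
  apply: mxrank_unit; rewrite unitmxE det_diag unitfE.
  by apply/prodf_neq0 => i _; rewrite mxE tofrac_eq0.
by move=> <-; rewrite dE mulmx_max_rank.
Qed.

(** * Walk sums as products of transition matrices *)

Section WalkSum.
Variables (R : comNzRingType) (V : finType).
Implicit Types (w : nat -> V -> V -> R).

Fixpoint walk_sum w (a k : nat) (u v : V) : R :=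
  if k is k'.+1 then \sum_x w a u x * walk_sum w a.+1 k' x v else (u == v)%:R.

Lemma eq_walk_sum w w' a k u v :
  (forall l, (a <= l < a + k)%N -> w l =2 w' l) ->
  walk_sum w a k u v = walk_sum w' a k u v.
Proof.
elim: k a u => //= k IH a u eqw; apply: eq_bigr => x _.
rewrite eqw ?IH // => [l ?|]; last by lia.
by apply: eqw; lia.
Qed.

Lemma walk_sumD w a k k' u v :
  walk_sum w a (k + k') u v =
  \sum_x walk_sum w a k u x * walk_sum w (a + k) k' x v.
Proof.
elim: k a u => [|k IH] a u /=.
  rewrite addn0 (bigD1 u) //= eqxx mul1r big1 ?addr0 // => x /negPf.
  by rewrite eq_sym => ->; rewrite mul0r.
under eq_bigr => x _ do rewrite IH mulr_sumr.
rewrite exchange_big /=; apply: eq_bigr => y _.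
rewrite mulr_suml; apply: eq_bigr => x _.
by rewrite mulrA addSnnS.
Qed.

Lemma walk_sum_layer w (lay : V -> nat) a k u v :
  (forall l x y, lay y != (lay x).+1 -> w l x y = 0) ->
  lay v != (lay u + k)%N -> walk_sum w a k u v = 0.
Proof.
move=> w0; elim: k a u => [|k IH] a u /= ne_uv.
  by case: (u =P v) ne_uv => // ->; rewrite addn0 eqxx.
apply: big1 => x _; have [eq_x|ne_x] := eqVneq (lay x) (lay u).+1; last first.
  by rewrite w0 ?mul0r.
by rewrite IH ?mulr0 // eq_x addSnnS.
Qed.

Definition ffun_cons k (xp : V * {ffun 'I_k -> V}) : {ffun 'I_k.+1 -> V} :=
  [ffun i => if unlift ord0 i is Some j then xp.2 j else xp.1].

Lemma ffun_cons0 k xp : @ffun_cons k xp ord0 = xp.1.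
Proof. by rewrite ffunE unlift_none. Qed.

Lemma ffun_consS k xp i : @ffun_cons k xp (lift ord0 i) = xp.2 i.
Proof. by rewrite ffunE liftK. Qed.

Lemma ffun_cons_bij k : bijective (@ffun_cons k).
Proof.
exists (fun p : {ffun 'I_k.+1 -> V} => (p ord0, [ffun i => p (lift ord0 i)])).
  move=> [x p]; rewrite ffun_cons0; congr (_, _).
  by apply/ffunP => i; rewrite ffunE ffun_consS.
move=> p; apply/ffunP => i; rewrite ffunE; case: unliftP => [j|] -> //=.
by rewrite ffunE.
Qed.

(** Induction on the length, splitting off the first vertex through [ffun_cons]: a sum over paths
    becomes an iterated matrix product, which can be cut at any layer. *)
Lemma walk_sum_ffun w a k u v :
  \sum_(p : {ffun 'I_k.+1 -> V} | (p ord0 == u) && (p ord_max == v))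
     \prod_(l < k) w (a + l)%N (p (widen_ord (leqnSn k) l)) (p (lift ord0 l))
  = walk_sum w a k u v.
Proof.
elim: k a u => [|k IH] a u /=.
  have [<-{v}|ne_uv] := eqVneq u v; last first.
    apply: big1 => p /andP[/eqP p0 /eqP pm]; case/eqP: ne_uv.
    by rewrite -p0 -pm; congr (p _); apply/val_inj.
  rewrite (big_pred1 [ffun=> u]) ?big_ord0 // => p /=.
  apply/andP/eqP => [[/eqP <- _]|->]; last by rewrite !ffunE eqxx.
  by apply/ffunP => i; rewrite ffunE ord1.
rewrite (reindex (@ffun_cons k.+1)) /=; last exact/onW_bij/ffun_cons_bij.
have ordm : ord_max = lift ord0 ord_max :> 'I_k.+2 by apply/val_inj.
pose G (p : {ffun 'I_k.+1 -> V}) := \prod_(l < k)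
   w (a.+1 + l)%N (p (widen_ord (leqnSn k) l)) (p (lift ord0 l)).
pose H (xp : V * {ffun 'I_k.+1 -> V}) := w a xp.1 (xp.2 ord0) * G xp.2.
rewrite (eq_big (fun xp : V * {ffun 'I_k.+1 -> V} =>
   (xp.1 == u) && (xp.2 ord_max == v)) H); first last.
- move=> [x p] _; rewrite big_ord_recl /=; congr (_ * _).
    rewrite addn0 ffun_consS.
    by rewrite (_ : widen_ord _ _ = ord0) ?ffun_cons0 //; apply/val_inj.
  apply: eq_bigr => l _; rewrite ffun_consS /bump /= add1n addSnnS.
  rewrite (_ : widen_ord _ _ = lift ord0 (widen_ord (leqnSn k) l)).
    by rewrite ffun_consS.
  exact/val_inj.
- by move=> [x p]; rewrite ffun_cons0 ordm ffun_consS.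
rewrite -(pair_big (pred1 u) (fun p : {ffun 'I_k.+1 -> V} => p ord_max == v)
  (fun x p => w a x (p ord0) * G p)) /= big_pred1_eq.
rewrite (partition_big (fun p : {ffun 'I_k.+1 -> V} => p ord0) predT) //=.
apply: eq_bigr => x _; rewrite -IH mulr_sumr; apply: eq_big => p.
  exact: andbC.
by case/andP=> _ /eqP ->.
Qed.

(* Blocks of [B] consecutive layers contribute rank-one factors, and cutting
   between two blocks costs a sum over the at most [r] vertices of a layer. *)
Lemma rank_walk_sum (S T : Type) (w : S -> T -> nat -> V -> V -> R)
    (wS : S -> nat -> V -> V -> R) (wT : T -> nat -> V -> V -> R)
    (lay : V -> nat) (side : nat -> bool) (B r j b k : nat) (u v : V) :
  (forall s t l, w s t l =2 if side (l %/ B)%N then wS s l else wT t l) ->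
  (forall s t l x y, lay y != (lay x).+1 -> w s t l x y = 0) ->
  (forall l, (#|[pred x | lay x == l]| <= r)%N) ->
  (k <= j * B)%N ->
  rank_at_most (r ^ j) (fun s t => walk_sum (w s t) (b * B) k u v).
Proof.
move=> wE w0 card_lay; elim: j b k u => [|j IH] b k u le_k.
  have -> : k = 0%N by lia.
  exact: rank_at_most_const.
set d := minn k B.
have [dk dB] : (d <= k)%N /\ (d <= B)%N by rewrite geq_minl geq_minr.
pose X := enum [pred x | lay x == (lay u + d)%N].
apply: (@rank_at_most_leq _ _ _ (size X * r ^ j)).
  by rewrite expnS leq_mul2r -cardE card_lay orbT.
apply: (@eq_rank_at_most _ _ _ _ (fun s t => \sum_(x <- X)
   walk_sum (w s t) (b * B) d u x * walk_sum (w s t) (b.+1 * B) (k - d) x v)).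
  move=> s t; rewrite -{2}(subnKC dk) walk_sumD big_enum big_mkcond /=.
  apply: eq_bigr => x _; case: ifPn => [_|ne_x].
    (* If [k <= B], the remaining walk is empty and its starting position is irrelevant; otherwise
       [d = B] and it starts at the next block boundary. *)
    have [kB|kB] := leqP k B.
      by have -> : (k - d = 0)%N by rewrite /d; lia.
    by congr (_ * walk_sum _ _ _ _ _); rewrite /d mulSn; lia.
  by rewrite (walk_sum_layer (w := w s t) (lay := lay)) ?mul0r //; exact: w0.
apply: rank_at_most_sum => x.
have rk1 : rank_at_most (r ^ j)
    (fun s t => walk_sum (w s t) (b.+1 * B) (k - d) x v).
  by apply: IH; rewrite /d; lia.
have blk l : (b * B <= l < b * B + d)%N -> (l %/ B = b)%N.
  move=> /andP[le_l lt_l]; have B0 : (0 < B)%N by lia.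
  apply/eqP; rewrite eqn_leq leq_divRL // le_l andbT -ltnS ltn_divLR //.
  by rewrite mulSn; lia.
case: (boolP (side b)) => sb.
- apply: eq_rank_at_most (rank_at_mostM
    (fun s => walk_sum (wS s) (b * B) d u x) (fun=> 1) rk1) => s t /=.
  rewrite mulr1; congr (_ * _); apply: eq_walk_sum => l /blk bl y z.
  by rewrite wE bl sb.
- apply: eq_rank_at_most (rank_at_mostM
    (fun=> 1) (fun t => walk_sum (wT t) (b * B) d u x) rk1) => s t /=.
  rewrite mul1r; congr (_ * _); apply: eq_walk_sum => l /blk bl y z.
  by rewrite wE bl (negPf sb).
Qed.

End WalkSum.

(** * Evaluation and rank of roABPs *)

Section Evaluation.
Variables (F : fieldType) (R : comNzRingType) (phi : {rmorphism F -> R}).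

(** Holds monomial by monomial, since the exponent of [v] is 0 or 1. It later replaces the
    substitution of g for t_2 by evaluations at the constants 0 and 1. *)
Lemma mmap_affine N (C : {mpoly F[N]}) (v : 'I_N) (h h0 h1 : 'I_N -> R) :
  (forall m, m \in msupp C -> (m v <= 1)%N) ->
  h0 v = 0 -> h1 v = 1 -> (forall i, i != v -> h0 i = h i) ->
  (forall i, i != v -> h1 i = h i) ->
  mmap phi h C = (1 - h v) * mmap phi h0 C + h v * mmap phi h1 C.
Proof.
move=> degC h0v h1v h0E h1E; rewrite !mulr_sumr -big_split /=.
apply: eq_big_seq => m /degC degm.
rewrite /mmap1 !(bigD1 (P := predT) v) //= h0v h1v.
have -> : \prod_(i < N | i != v) h0 i ^+ m i = \prod_(i < N | i != v) h i ^+ m i.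
  by apply: eq_bigr => i /h0E ->.
have -> : \prod_(i < N | i != v) h1 i ^+ m i = \prod_(i < N | i != v) h i ^+ m i.
  by apply: eq_bigr => i /h1E ->.
by case: (m v) degm => [|[|//]] _; rewrite ?expr0 ?expr1; ring.
Qed.

Variables (N : nat) (A : roABP F N).

(** Non-edges and positions [l >= N] get weight 0, so that sums over all vertex sequences can
    replace sums over paths. *)
Definition ro_weight (h : 'I_N -> R) (l : nat) (u v : ro_vertex A) : R :=
  if insub l is Some k then
    (ro_edge u v)%:R * (map_poly phi (ro_label u v)).[h (ro_order A k)]
  else 0.

Lemma mmap_ro_poly h :
  mmap phi h (ro_poly A) =
  walk_sum (ro_weight h) 0 N (ro_source A) (ro_sink A).
Proof.
rewrite rmorph_sum /= -walk_sum_ffun /ro_path.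
rewrite [RHS](bigID (fun p : {ffun 'I_N.+1 -> ro_vertex A} => [forall l : 'I_N,
  ro_edge (p (widen_ord (leqnSn N) l)) (p (lift ord0 l))])) /=.
rewrite [X in _ = _ + X]big1 ?addr0; last first.
  move=> p /andP[_ /forallPn[l /negPf nedge]].
  by rewrite (bigD1 l) //= /ro_weight add0n valK nedge !mul0r.
apply: eq_big => [p|p /and3P[_ _ /forallP edge]]; first by rewrite andbA.
rewrite rmorph_prod; apply: eq_bigr => l _ /=.
rewrite /ro_weight add0n valK edge mul1r.
set q := ro_label _ _; elim/poly_ind: q => [|q c IH]; first by rewrite !rmorph0 horner0.
rewrite !rmorphD !rmorphM /= !hornerE /= map_polyX map_polyC !hornerE -IH.
rewrite /horner_alg /horner_morph map_polyX map_polyC !hornerE /=.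
by rewrite mmapZ rmorph1 mulr1 mmapX mmap1U.
Qed.

(** Each position reads one variable, so within a block all weights depend on [s] alone or on [t]
    alone; each of the [j] blocks costs a factor of the width. *)
Lemma rank_ro_poly (S T : Type) (h : S -> T -> 'I_N -> R)
    (hS : S -> 'I_N -> R) (hT : T -> 'I_N -> R) (side : nat -> bool)
    (B j : nat) :
  (forall s t (l : 'I_N), h s t (ro_order A l) =
     if side (l %/ B)%N then hS s (ro_order A l) else hT t (ro_order A l)) ->
  (N <= j * B)%N ->
  rank_at_most (ro_width A ^ j) (fun s t => mmap phi (h s t) (ro_poly A)).
Proof.
move=> hE le_N.
apply: (@eq_rank_at_most _ _ _ _ (fun s t => walk_sum (ro_weight (h s t))
  (0 * B) N (ro_source A) (ro_sink A))).
  by move=> s t; rewrite mmap_ro_poly mul0n.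
apply: (rank_walk_sum (wS := fun s => ro_weight (hS s))
  (wT := fun t => ro_weight (hT t)) (lay := fun v => ro_layer v)
  (side := side)) => //.
- move=> s t l x y; rewrite /ro_weight.
  case: insubP => [k lt_lN kE|_]; last by case: ifP.
  by rewrite hE -kE /=; case: ifP.
- move=> s t l x y; rewrite /ro_weight; case: insubP => // k _ _.
  by case: (boolP (ro_edge x y)) => [/ro_edgeP ->|]; rewrite ?eqxx ?mul0r.
- move=> l; have [lt_l|ge_l] := ltnP l N.+1; last first.
    rewrite eq_card0 // => x; rewrite !inE; apply/negbTE.
    by rewrite neq_ltn (leq_trans (ltn_ord _) ge_l).
  apply: leq_trans (leq_bigmax (Ordinal lt_l)).
  by apply: subset_leq_card; apply/subsetP => x; rewrite !inE.
Qed.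

Lemma mmap_ro_degree0 h h' :
  ro_degree A = 0%N -> mmap phi h (ro_poly A) = mmap phi h' (ro_poly A).
Proof.
move=> deg0; rewrite !mmap_ro_poly; apply: eq_walk_sum => l _ u v.
rewrite /ro_weight; case: insub => // k.
case: (boolP (ro_edge u v)) => [edge|]; last by rewrite !mul0r.
have : ((size (ro_label u v)).-1 <= 0)%N.
  by rewrite -deg0 /ro_degree (leq_bigmax_cond (u, v)).
rewrite leqn0 -subn1 subn_eq0 => /size1_polyC ->.
by rewrite map_polyC !hornerE.
Qed.

End Evaluation.

(** * Evaluation of certificates and of the system; its unsatisfiability *)

Section Substitution.
Variables (F : fieldType) (R : comNzRingType) (phi : {rmorphism F -> R}).

Lemma mmap_comp N k (C : {mpoly F[N]}) (lq : N.-tuple {mpoly F[k]})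
    (h : 'I_k -> R) :
  mmap phi h (C \mPo lq) = mmap phi (fun i => mmap phi h (tnth lq i)) C.
Proof.
rewrite comp_mpolyE rmorph_sum; apply: eq_bigr => m _ /=.
rewrite mmapZ rmorph_prod; congr (_ * _); apply: eq_bigr => i _.
by rewrite rmorphXn.
Qed.

Variable n : nat.
Implicit Types (C : {mpoly F[n + (2 + n)]}) (P s : 'I_n -> R) (a b : R).

Definition ips_point P a b s (v : 'I_(n + (2 + n))) : R :=
  match split v with
  | inl i => P i
  | inr w => match split w with
             | inl k => if k == ord0 then a else b
             | inr i => s i
             end
  end.

Lemma ips_point_x P a b s i : ips_point P a b s (lshift (2 + n) i) = P i.
Proof. by rewrite /ips_point (unsplitK (inl i)). Qed.

Lemma ips_point_t P a b s k :
  ips_point P a b s (t_var n k) = if k == ord0 then a else b.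
Proof.
rewrite /ips_point /t_var (unsplitK (inr (lshift n k))).
by rewrite (unsplitK (inl k)).
Qed.

Lemma ips_point_s P a b s i :
  ips_point P a b s (rshift n (rshift 2 i)) = s i.
Proof. by rewrite /ips_point !(unsplitK (inr _)). Qed.

Lemma mmap_ips_subst C f g (h : 'I_n -> {mpoly F[n]}) P :
  mmap phi P (ips_subst C f g h) =
  mmap phi (ips_point P (mmap phi P f) (mmap phi P g)
                        (fun i => mmap phi P (h i))) C.
Proof.
rewrite mmap_comp; apply: eq_bigr => m _; congr (_ * _).
apply: mmap1_eq => v; rewrite -(splitK v).
case: (split v) => [i|w] /=.
  by rewrite tnth_lshift tnth_mktuple ips_point_x mmapX mmap1U.
rewrite -(splitK w) tnth_rshift; case: (split w) => [k|i] /=.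
  rewrite tnth_lshift ips_point_t.
  by case: (unliftP ord0 k) => [j|] -> //=; rewrite ord1.
by rewrite tnth_rshift tnth_mktuple ips_point_s.
Qed.

Lemma mmap_f_poly P :
  mmap phi P (f_poly F n) =
  \prod_(i < n) \prod_(j < n | (i < j)%N) (P i + P j + 1).
Proof.
rewrite rmorph_prod; apply: eq_bigr => i _; rewrite rmorph_prod.
apply: eq_bigr => j _ /=.
by rewrite !rmorphD rmorph1 /= !mmapX !mmap1U.
Qed.

Lemma mmap_f_poly0 P i j :
  i != j -> P i + P j + 1 = 0 -> mmap phi P (f_poly F n) = 0.
Proof.
wlog lt_ij : i j / (i < j)%N => [IH ne_ij Pij|_ Pij].
  case: (ltngtP i j) => [||/val_inj eq_ij]; first by move=> /IH; apply.
    by move=> /IH; apply; rewrite 1?eq_sym // (addrC (P j)).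
  by rewrite eq_ij eqxx in ne_ij.
by rewrite mmap_f_poly (bigD1 i) //= (bigD1 j) //= Pij !mul0r.
Qed.

Lemma mmap_g_poly P :
  mmap phi P (g_poly F n) = \prod_(i < n) (1 - P i) - 1.
Proof.
rewrite rmorphB rmorph1 rmorph_prod; congr (_ - _); apply: eq_bigr => i _.
by rewrite rmorphB rmorph1 /= mmapX mmap1U.
Qed.

Lemma mmap_bool_axiom P i :
  mmap phi P (bool_axiom F i) = P i ^+ 2 - P i.
Proof. by rewrite rmorphB rmorphXn /= mmapX mmap1U. Qed.

End Substitution.

(** Solutions are Boolean, and a coordinate equal to 1 would give g the value -1. Only the origin
    remains, where f is 1. *)
Lemma unsatisfiable_system (F : fieldType) (n : nat) :
  ~ satisfiable (f_poly F n) (g_poly F n).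
Proof.
move=> [a []]; rewrite /meval mmap_f_poly mmap_g_poly => f0 g0 bool_a.
have a0 i : a i = 0.
  have := bool_a i; rewrite mmap_bool_axiom => /eqP.
  rewrite -[X in _ - X]mul1r expr2 -mulrBl mulf_eq0 => /orP[|/eqP //].
  rewrite subr_eq0 => /eqP ai1; move/eqP: g0.
  by rewrite (bigD1 i) //= ai1 subrr mul0r sub0r oppr_eq0 oner_eq0.
move/eqP: f0; rewrite big1 ?oner_eq0 // => i _.
by rewrite big1 // => j _; rewrite !a0 !add0r.
Qed.

(** * The defect matrix of a matching and the resulting width bound *)

Section Matching.
Variables (F : fieldType) (n m : nat) (eY eZ : 'I_m -> 'I_n).
Hypotheses (eY_inj : injective eY) (eZ_inj : injective eZ).
Hypothesis eYZ : forall k l, eY k != eZ l.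
Implicit Types (s t : {ffun 'I_m -> bool}).

Local Notation R := {mpoly F[n]}.
Local Notation phi := (@mpolyC n F).

(* Row [s] chooses the values on Y and column [t] those on Z; if [s k] and [t k]
   differ, the k-th matched pair makes a factor of f vanish. *)
Definition swap_point s t (i : 'I_n) : R :=
  if [pick k | eY k == i] is Some k then
    if s k then -1 - 'X_(eZ k) else 'X_i
  else if [pick k | eZ k == i] is Some k then
    if t k then -1 - 'X_(eY k) else 'X_i
  else 'X_i.

Lemma swap_pointY s t k :
  swap_point s t (eY k) = if s k then -1 - 'X_(eZ k) else 'X_(eY k).
Proof.
rewrite /swap_point; case: pickP => [l /eqP/eY_inj -> //|/(_ k)].
by rewrite eqxx.
Qed.

Lemma swap_pointZ s t k :
  swap_point s t (eZ k) = if t k then -1 - 'X_(eY k) else 'X_(eZ k).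
Proof.
rewrite /swap_point; case: pickP => [l|_]; first by rewrite (negPf (eYZ _ _)).
by case: pickP => [l /eqP/eZ_inj -> //|/(_ k)]; rewrite eqxx.
Qed.

Lemma swap_pointN s t i :
  (forall k, eY k != i) -> (forall k, eZ k != i) -> swap_point s t i = 'X_i.
Proof.
move=> nY nZ; rewrite /swap_point.
case: pickP => [k|_]; first by rewrite (negPf (nY k)).
by case: pickP => // k; rewrite (negPf (nZ k)).
Qed.

Lemma swap_point_indepT s t t' i :
  (forall k, eZ k != i) -> swap_point s t i = swap_point s t' i.
Proof.
move=> nZ; rewrite /swap_point; case: pickP => // _.
by case: pickP => // k; rewrite (negPf (nZ k)).
Qed.

Lemma swap_point_indepS s s' t i :
  (forall k, eY k != i) -> swap_point s t i = swap_point s' t i.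
Proof.
by move=> nY; rewrite /swap_point; case: pickP => // k; rewrite (negPf (nY k)).
Qed.

Lemma f_swap_point s t :
  s != t -> mmap phi (swap_point s t) (f_poly F n) = 0.
Proof.
move=> ne_st; have [k ne_k] : exists k, s k != t k.
  apply/existsP; apply: contraR ne_st => /existsPn eq_st.
  by apply/eqP/ffunP => k; apply/eqP; rewrite -[_ == _]negbK.
apply: (mmap_f_poly0 _ (P := swap_point s t) (eYZ k k)); rewrite swap_pointY swap_pointZ.
by case: (s k) (t k) ne_k => [] [] //= _; ring.
Qed.

Definition swap_zero s (i : 'I_n) : F :=
  if [exists k, s k && ((eY k == i) || (eZ k == i))] then -1 else 0.

Lemma swap_zeroY s k : swap_zero s (eY k) = if s k then -1 else 0.
Proof.
rewrite /swap_zero; congr (if _ then _ else _); apply/existsP/idP.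
  by move=> [l /andP[sl]]; rewrite (inj_eq eY_inj) [eZ _ == _]eq_sym (negPf (eYZ _ _)) orbF
    => /eqP <-.
by move=> sk; exists k; rewrite sk eqxx.
Qed.

Lemma swap_zeroZ s k : swap_zero s (eZ k) = if s k then -1 else 0.
Proof.
rewrite /swap_zero; congr (if _ then _ else _); apply/existsP/idP.
  by move=> [l /andP[sl]]; rewrite (inj_eq eZ_inj) (negPf (eYZ _ _)) /=
    => /eqP <-.
by move=> sk; exists k; rewrite sk eqxx orbT.
Qed.

(* The involution [swap_point s s] sends [swap_zero s] to the origin. *)
Lemma meval_swap_point s i : (swap_point s s i).@[swap_zero s] = 0.
Proof.
case: (boolP [exists k, eY k == i]) => [/existsP[k /eqP <-]|/existsPn nY].
  rewrite swap_pointY; case: ifP => sk; last by rewrite mevalXU swap_zeroY sk.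
  by rewrite mevalB mevalN meval1 mevalXU swap_zeroZ sk subrr.
case: (boolP [exists k, eZ k == i]) => [/existsP[k /eqP <-]|/existsPn nZ].
  rewrite swap_pointZ; case: ifP => sk; last by rewrite mevalXU swap_zeroZ sk.
  by rewrite mevalB mevalN meval1 mevalXU swap_zeroY sk subrr.
rewrite swap_pointN // mevalXU /swap_zero; case: existsP => // -[k].
by rewrite (negPf (nY k)) (negPf (nZ k)) andbF.
Qed.

Variable C : {mpoly F[n + (2 + n)]}.
Hypothesis refC : ips_lin'_refutation (f_poly F n) (g_poly F n) C.

(** Here t_1 is 0 and the value [b] of t_2 is left free for interpolation. *)
Definition t2_point (b : R) s t : 'I_(n + (2 + n)) -> R :=
  ips_point (swap_point s t) 0 b
    (fun i => swap_point s t i ^+ 2 - swap_point s t i).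

Definition defect s t : R :=
  1 - mmap phi (t2_point (mmap phi (swap_point s t) (g_poly F n)) s t) C.

(** Off the diagonal f vanishes, so setting t_1 to 0 agrees with substituting f, and the refutation
    identity gives C the value 1. *)
Lemma defect_offdiag s t : s != t -> defect s t = 0.
Proof.
move=> ne_st; case: refC => _ /(congr1 (mmap phi (swap_point s t))) eq1 _.
move: eq1; rewrite mmap_ips_subst rmorph1 f_swap_point // => eq1.
apply/eqP; rewrite subr_eq0 eq_sym -[X in _ == X]eq1; apply/eqP.
apply: eq_bigr => d _; congr (_ * _); apply: mmap1_eq => v.
rewrite /t2_point /ips_point; case: split => // w; case: split => // i.
by rewrite mmap_bool_axiom.
Qed.

(** At [swap_zero s] all coordinates of the swapped point vanish, and with them g and the Boolean
    axioms; C(0, 0, 0, 0) = 0 then gives the entry the value 1 there. *)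
Lemma defect_diag s : defect s s != 0.
Proof.
suff : (defect s s).@[swap_zero s] = 1.
  by apply: contra_eq_neq => ->; rewrite meval0 eq_sym oner_eq0.
case: refC => /(congr1 (meval (fun=> 0))) C0 _ _.
move: C0; rewrite meval0 [LHS]mmap_ips_subst => C0.
rewrite /defect mevalB meval1 -[RHS]subr0; congr (_ - _).
rewrite -[RHS]C0 [in LHS]raddf_sum; apply: eq_bigr => d _.
rewrite /= mevalM mevalC; congr (_ * _); rewrite rmorph_prod.
apply: eq_bigr => v _; rewrite /= rmorphXn; congr (_ ^+ _).
rewrite /t2_point /ips_point !rmorph0; case: split => [i|w].
  exact: meval_swap_point.
case: split => [k|i]; last first.
  by rewrite rmorphB rmorphXn /= meval_swap_point expr0n subr0.
case: ifP => _; first exact: meval0.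
rewrite mmap_g_poly rmorphB rmorph1 rmorph_prod big1 ?subrr // => i _.
by rewrite rmorphB rmorph1 /= meval_swap_point subr0.
Qed.

Let G s t : R := \prod_(i < n) (1 - swap_point s t i).

Lemma t2_point_neq b b' s t v :
  v != t_var n ord_max -> t2_point b s t v = t2_point b' s t v.
Proof.
rewrite /t2_point -(splitK v); case: (split v) => [i|w] /=.
  by rewrite !ips_point_x.
rewrite -(splitK w); case: (split w) => [k|i] /=; last by rewrite !ips_point_s.
rewrite !ips_point_t; case: (unliftP ord0 k) => [j|] -> //= /eqP[].
by congr (rshift n (lshift n _)); rewrite ord1; apply/val_inj.
Qed.

(** Interpolation in t_2 at g = G - 1, expanded into terms whose ranks are bounded separately; the 2
    comes from 1 - g = 2 - G. *)
Lemma defectE s t :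
  defect s t = 1 + (- 2%:R * mmap phi (t2_point 0 s t) C
    + (mmap phi (t2_point 1 s t) C + (G s t * mmap phi (t2_point 0 s t) C
    + -1 * (G s t * mmap phi (t2_point 1 s t) C)))).
Proof.
have [_ _ /(_ ord_max) degC] := refC.
rewrite /defect (mmap_affine _ (v := t_var n ord_max)
  (h0 := t2_point 0 s t) (h1 := t2_point 1 s t)) //.
- by rewrite /t2_point ips_point_t /= mmap_g_poly -/(G s t); ring.
- by rewrite /t2_point ips_point_t.
- by rewrite /t2_point ips_point_t.
- by move=> v; apply: t2_point_neq.
- by move=> v; apply: t2_point_neq.
Qed.

(** Every factor of [G] depends on at most one of [s] and [t], so [G] is a row factor times a column
    factor. *)
Lemma rank_prod_swap_point k M :
  rank_at_most k M -> rank_at_most k (fun s t => G s t * M s t).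
Proof.
(* An arbitrary filler for the argument on which a value does not depend. *)
pose z : {ffun 'I_m -> bool} := [ffun=> false].
pose inZ i := [exists k, eZ k == i].
move=> /(rank_at_mostM (fun s => \prod_(i | ~~ inZ i) (1 - swap_point s z i))
  (fun t => \prod_(i | inZ i) (1 - swap_point z t i))).
apply: eq_rank_at_most => s t; congr (_ * _).
rewrite /G [RHS](bigID inZ) /= mulrC; congr (_ * _); apply: eq_bigr => i.
  move=> /existsP[l /eqP <-]; congr (1 - _); apply: swap_point_indepS => l'.
  exact: eYZ.
by move=> /existsPn nZ; congr (1 - _); apply: swap_point_indepT.
Qed.

End Matching.

(** [side] assigns blocks of positions to rows or to columns: rows get both reads of each index in
    Y, columns both reads of each index in Z. All other variables, t_1 and t_2 included, have values
    independent of [s] and [t]. The defect matrix has 2^m rows and, by [defectE], rank at most 1 + 4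
    r^4. *)
Lemma matching_width_bound (F : fieldType) (n m B : nat)
    (A : roABP F (n + (2 + n))) (eY eZ : 'I_m -> 'I_n) (side : nat -> bool) :
  let vside v := side ((ro_order A)^-1%g v %/ B)%N in
  injective eY -> injective eZ -> (n + (2 + n) <= 4 * B)%N ->
  (forall k, vside (lshift (2 + n) (eY k)) && vside (rshift n (rshift 2 (eY k)))) ->
  (forall k, ~~ vside (lshift (2 + n) (eZ k)) &&
             ~~ vside (rshift n (rshift 2 (eZ k)))) ->
  roABP_ips_lin'_refutation (f_poly F n) (g_poly F n) A ->
  (2 ^ m <= 1 + 4 * ro_width A ^ 4)%N.
Proof.
move=> vside eY_inj eZ_inj le_B sideY sideZ refA.
have eYZ k l : eY k != eZ l.
  by apply/eqP => eq_kl; have := sideZ l; rewrite -eq_kl; case/andP: (sideY k) => ->.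
set r := ro_width A.
pose z : {ffun 'I_m -> bool} := [ffun=> false].
have rkC b : rank_at_most (r ^ 4)
    (fun s t => mmap (@mpolyC n F) (t2_point (F := F) eY eZ b s t) (ro_poly A)).
  apply: (rank_ro_poly _ (hS := fun s => t2_point eY eZ b s z)
    (hT := fun t => t2_point eY eZ b z t) (side := side) (B := B)) => // s t l.
  set v := ro_order A l.
  have -> : side (l %/ B)%N = vside v by rewrite /vside /v permK.
  rewrite /t2_point; have := splitK v; case: (split v) => [i|w] /= <-.
    rewrite !ips_point_x; case: ifPn => sv.
      apply: swap_point_indepT => k; apply: contraTneq sv => <-.
      by case/andP: (sideZ k).
    apply: swap_point_indepS => k; apply: contraNneq sv => <-.
    by case/andP: (sideY k).
  have := splitK w; case: (split w) => [k|i] /= <-.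
    by rewrite -/(t_var n k) !ips_point_t; case: (vside _).
  rewrite !ips_point_s; case: ifPn => sv.
    rewrite (@swap_point_indepT _ _ _ eY eZ s t z) // => k.
    by apply: contraTneq sv => <-; case/andP: (sideZ k).
  rewrite (@swap_point_indepS _ _ _ eY eZ s z t) // => k.
  by apply: contraNneq sv => <-; case/andP: (sideY k).
have := rank_at_most_diag (defect_offdiag eY_inj eZ_inj eYZ refA)
  (defect_diag eY_inj eZ_inj eYZ refA).
rewrite card_ffun card_bool card_ord; apply.
rewrite !mulSn mul0n addn0.
apply: eq_rank_at_most (rank_at_mostD (rank_at_most_const _ _ 1)
  (rank_at_mostD (rank_at_mostZ (- 2%:R) (rkC 0)) (rank_at_mostD (rkC 1)
  (rank_at_mostD (rank_prod_swap_point eYZ (rkC 0))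
     (rank_at_mostZ (-1) (rank_prod_swap_point eYZ (rkC 1))))))) => s t.
by rewrite (defectE _ _ refA).
Qed.

(** The degree is a factor of the size, so it must be positive for width to bound size. In degree 0
    the certificate would be constant, yet it takes the values 0 and 1. *)
Lemma refutation_degree_gt0 (F : fieldType) (n : nat)
    (f g : {mpoly F[n]}) (A : roABP F (n + (2 + n))) :
  roABP_ips_lin'_refutation f g A -> (0 < ro_degree A)%N.
Proof.
case=> C0 C1 _; rewrite lt0n; apply/eqP => deg0.
have := oner_neq0 {mpoly F[n]}; rewrite -C0 -C1 => /eqP; apply.
exact: mmap_ro_degree0.
Qed.

(** * Choosing balanced blocks and a matching *)

Section BalancedSides.
Local Open Scope nat_scope.

Lemma card_sum_bool (T : finType) (P : pred T) : #|P| = \sum_x (P x : nat).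
Proof.
rewrite -sum1_card big_mkcond; apply: eq_bigr => x _; rewrite unfold_in.
by case: (P x).
Qed.

(** All reads are at distinct positions, and a block has only [B] positions. *)
Lemma card_block (n N B b : nat) (p1 p2 : 'I_n -> 'I_N) :
  0 < B -> injective p1 -> injective p2 -> (forall i j, p1 i != p2 j) ->
  #|[pred i | p1 i %/ B == b]| + #|[pred i | p2 i %/ B == b]| <= B.
Proof.
move=> B0 p1_inj p2_inj p12.
rewrite !cardE -(size_map (fun i => val (p1 i))).
rewrite -(size_map (fun i => val (p2 i)) (enum [pred i | p2 i %/ B == b])).
rewrite -size_cat -[leqRHS](size_iota (b * B)); apply: uniq_leq_size.
  rewrite cat_uniq !map_inj_uniq ?enum_uniq ?andbT /=.
  - apply/hasPn => _ /mapP[j _ ->]; apply/mapP => -[i _ /val_inj eq_ij].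
    by have := p12 i j; rewrite eq_ij eqxx.
  - by move=> i j /val_inj /p2_inj.
  - by move=> i j /val_inj /p1_inj.
have blk l : l %/ B == b -> l \in iota (b * B) B.
  move=> /eqP <-; rewrite mem_iota leq_divM /= {1}(divn_eq l B) ltn_add2l.
  exact: ltn_pmod.
move=> l; rewrite mem_cat => /orP[] /mapP[i]; rewrite mem_enum inE => Pi ->;
  exact: blk.
Qed.

Definition pair_side (a b : nat) : bool := (b == 0) || (b == a).

(* The blocks have almost equal sizes, so each of the three ways of pairing
   the four blocks leaves almost as many indices inside the first pair as
   inside the second; every index lies inside a pair for at least one way. *)
Lemma balanced_sides (n m B N : nat) (p1 p2 : 'I_n -> 'I_N) :
  injective p1 -> injective p2 -> (forall i j, p1 i != p2 j) ->
  N <= 4 * B <= n.*2 + 6 -> 6 * m + 4 <= n ->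
  exists side : nat -> bool,
    m <= #|[pred i | side (p1 i %/ B) && side (p2 i %/ B)]| /\
    m <= #|[pred i | ~~ side (p1 i %/ B) && ~~ side (p2 i %/ B)]|.
Proof.
move=> p1_inj p2_inj p12 /andP[le_N le_B] le_m.
have B0 : 0 < B.
  have i0 : 'I_n by apply: (@Ordinal n 0); lia.
  by have := ltn_ord (p1 i0); lia.
pose u1 i := p1 i %/ B; pose u2 i := p2 i %/ B.
have u1_lt i : u1 i < 4.
  by rewrite ltn_divLR //; apply: leq_trans (ltn_ord _) le_N.
have u2_lt i : u2 i < 4.
  by rewrite ltn_divLR //; apply: leq_trans (ltn_ord _) le_N.
pose d b := \sum_(i < n) ((u1 i == b) + (u2 i == b)).
have d_le b : d b <= B.
  by rewrite /d big_split /= -!card_sum_bool; apply: card_block.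
pose Y side := #|[pred i | side (u1 i) && side (u2 i)]|.
pose Z side := #|[pred i | ~~ side (u1 i) && ~~ side (u2 i)]|.
have sumn1 : \sum_(i < n) 1 = n by rewrite sum1_card card_ord.
(* Index by index: the number of reads inside a pair of blocks, plus 1 if both fall outside, equals
   1, plus 1 if both fall inside. *)
have bal a b c : (a, b, c) \in [:: (1, 2, 3); (2, 1, 3); (3, 1, 2)] ->
    d 0 + d a + Z (pair_side a) = n + Y (pair_side a) /\
    d b + d c + Y (pair_side a) = n + Z (pair_side a).
  rewrite !inE -sumn1 /Y /Z /d !card_sum_bool -!big_split /=.
  case/or3P => /eqP[-> -> ->];
    split; apply: eq_bigr => i _; move: (u1_lt i) (u2_lt i);
    by case: (u1 i) (u2 i) => [|[|[|[|?]]]] [|[|[|[|?]]]].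
have cov : n <= (Y (pair_side 1) + Z (pair_side 1)) +
  ((Y (pair_side 2) + Z (pair_side 2)) + (Y (pair_side 3) + Z (pair_side 3))).
  rewrite -{1}sumn1 /Y /Z !card_sum_bool -!big_split /=.
  apply: leq_sum => i _; rewrite /pair_side.
  by case: (u1 i) (u2 i) (u1_lt i) (u2_lt i) => [|[|[|[|?]]]] [|[|[|[|?]]]].
have [Y1 Z1] := bal 1 2 3 isT; have [Y2 Z2] := bal 2 1 3 isT.
have [Y3 Z3] := bal 3 1 2 isT.
have := (d_le 0, d_le 1, d_le 2, d_le 3) => -[[[d0 d1] d2] d3].
(* By [bal] and [d_le], Y and Z differ by at most 3 for each pairing. If all three pairings failed,
   each Y + Z would be at most 2(m - 1) + 3, and [cov] would give n <= 6m + 3. *)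
have [a [mY mZ]] : exists a, m <= Y (pair_side a) /\ m <= Z (pair_side a).
  have [mY1|mY1] := boolP ((m <= Y (pair_side 1)) && (m <= Z (pair_side 1))).
    by exists 1; apply/andP.
  have [mY2|mY2] := boolP ((m <= Y (pair_side 2)) && (m <= Z (pair_side 2))).
    by exists 2; apply/andP.
  exists 3; lia.
by exists (pair_side a).
Qed.

(** The first [m] indices on each side are taken; any matching between them works, because f has a
    factor for every pair of indices. *)
Lemma balanced_matching (n m B N : nat) (p1 p2 : 'I_n -> 'I_N) :
  injective p1 -> injective p2 -> (forall i j, p1 i != p2 j) ->
  N <= 4 * B <= n.*2 + 6 -> 6 * m + 4 <= n ->
  exists (side : nat -> bool) (eY eZ : 'I_m -> 'I_n),
  [/\ injective eY, injective eZ,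
      forall k, side (p1 (eY k) %/ B) && side (p2 (eY k) %/ B) &
      forall k, ~~ side (p1 (eZ k) %/ B) && ~~ side (p2 (eZ k) %/ B)].
Proof.
move=> p1_inj p2_inj p12 le_B le_m.
have [side [mY mZ]] := balanced_sides p1_inj p2_inj p12 le_B le_m.
exists side, (fun k => enum_val (widen_ord mY k)),
  (fun k => enum_val (widen_ord mZ k)); split.
- by move=> k l /enum_val_inj /(congr1 val) /= /val_inj.
- by move=> k l /enum_val_inj /(congr1 val) /= /val_inj.
- by move=> k; have := enum_valP (widen_ord mY k); rewrite inE.
- by move=> k; have := enum_valP (widen_ord mZ k); rewrite inE.
Qed.

End BalancedSides.

(** * From width to size *)

Lemma refutation_width_bound (F : fieldType) (n m : nat)
    (A : roABP F (n + (2 + n))) :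
  (6 * m + 4 <= n)%N ->
  roABP_ips_lin'_refutation (f_poly F n) (g_poly F n) A ->
  (2 ^ m <= 1 + 4 * ro_width A ^ 4)%N.
Proof.
(* Four blocks of this size cover all 2n + 2 positions, and 4B <= 2n + 6. *)
move=> le_m refA; set B := ((n + (2 + n)) %/ 4).+1.
pose p1 i := (ro_order A)^-1%g (lshift (2 + n) i).
pose p2 i := (ro_order A)^-1%g (rshift n (rshift 2 i)).
have p1_inj : injective p1 by move=> i j /perm_inj /lshift_inj.
have p2_inj : injective p2 by move=> i j /perm_inj /rshift_inj /rshift_inj.
have p12 i j : p1 i != p2 j by rewrite (inj_eq perm_inj) eq_lrshift.
have le_B : (n + (2 + n) <= 4 * B <= n.*2 + 6)%N by rewrite /B; lia.
have [side [eY [eZ [eY_inj eZ_inj sideY sideZ]]]] :=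
  balanced_matching p1_inj p2_inj p12 le_B le_m.
by case/andP: le_B => le_B _; apply: matching_width_bound sideY sideZ refA.
Qed.

(** For m = n / 7 and n >= 42 one has m >= 6 and 6m + 4 <= n <= 8m. From 2^m <= 1 + 4 s^4 <= 8 s^4
    and m <= 2(m - 3) follows 2^m <= s^8, and n <= 8m gives the exponent 64. *)
Lemma refutation_size_bound (F : fieldType) (n : nat)
    (A : roABP F (n + (2 + n))) :
  (42 <= n)%N -> roABP_ips_lin'_refutation (f_poly F n) (g_poly F n) A ->
  (2 ^ n <= ro_size A ^ 64)%N.
Proof.
move=> n42 refA; set m := (n %/ 7)%N.
have := @refutation_width_bound _ _ m _ _ refA.
have deg_gt0 := refutation_degree_gt0 refA.
have : (ro_width A <= ro_size A)%N.
  by rewrite /ro_size -mulnA mulnAC leq_pmull // !muln_gt0 deg_gt0; lia.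
set r := ro_width A; set s := ro_size A => le_rs bound.
have m6 : (6 <= m)%N by rewrite /m; lia.
have le_m : (2 ^ m <= 1 + 4 * r ^ 4)%N by apply: bound; rewrite /m; lia.
(* Positivity of the width lets the summand 1 be absorbed into r^4. *)
have r0 : (0 < r)%N.
  rewrite lt0n; apply/eqP => r0; move: le_m; rewrite r0 leqNgt.
  by rewrite (@ltn_exp2l 2 0) //; lia.
have le_m3 : (2 ^ (m - 3) <= s ^ 4)%N.
  rewrite -(leq_pmul2l (isT : 0 < 2 ^ 3)%N) -expnD subnKC; last by lia.
  have : (1 <= r ^ 4 <= s ^ 4)%N by rewrite expn_gt0 r0 leq_exp2r.
  by move: le_m; rewrite (_ : 2 ^ 3 = 8)%N //; lia.
have le_m8 : (2 ^ m <= s ^ 8)%N.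
  rewrite (expnM s 4 2); apply: (@leq_trans ((2 ^ (m - 3)) ^ 2)).
    by rewrite -expnM leq_exp2l //; lia.
  by rewrite leq_exp2r.
rewrite (expnM s 8 8); apply: (@leq_trans ((2 ^ m) ^ 8)).
  by rewrite -expnM leq_exp2l // /m; lia.
by rewrite leq_exp2r.
Qed.

Theorem theorem5p9 (R : realType) (q : nat) (hq : prime q) :
  (forall (F : finFieldType) (n : nat), q \in [pchar F] ->
     ~ satisfiable (f_poly F n) (g_poly F n)) /\
  (exists (c : R) (n0 : nat), 0 < c /\
     forall (F : finFieldType) (n : nat), q \in [pchar F] -> (n0 <= n)%N ->
     forall A : roABP F (n + (2 + n)),
       roABP_ips_lin'_refutation (f_poly F n) (g_poly F n) A ->
       expR (c * n%:R) <= (ro_size A)%:R).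
Proof.
split=> [F n _|]; first exact: unsatisfiable_system.
(* With this constant, taking 64th powers turns the claim into [2 ^ n <= ro_size A ^ 64]. *)
exists (ln 2%:R / 64%:R), 42%N; split=> [|F n _ n42 A refA].
  by rewrite divr_gt0 ?ltr0n // ln_gt0 // ltr1n.
rewrite -(@ler_pXn2r _ 64) ?nnegrE ?expR_ge0 ?ler0n // -expRM_natr.
rewrite mulrAC divfK ?pnatr_eq0 // expRM_natr lnK ?posrE ?ltr0n //.
by rewrite -!natrX ler_nat refutation_size_bound.
Qed.
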